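(* Let $d\in\mathbb N$ and $r>0$. There exists a constant $c>0$, independent of $m$, such that for all natural numbers $m\ge 2$ $$ \varrho_m^o(\mathbf H^r_\infty,L_1)\ \ge\ c\, m^{-r}(\log m)^{d-1}. $$
   Context: Functions are (complex valued) $2\pi$-periodic in each of $d$ variables, defined on $\mathbb T^d:=[0,2\pi]^d$, with $\|f\|_1:=(2\pi)^{-d}\int_{\mathbb T^d}|f(\mathbf x)|d\mathbf x$ and $\|f\|_\infty:=\sup_{\mathbf x\in\mathbb T^d}|f(\mathbf x)|$; $L_p=L_p(\mathbb T^d)$ is taken with respect to the normalized Lebesgue measure. Class $\mathbf H^r_\infty$. For $\mathbf t=(t_1,\dots,t_d)$ and $l\in\mathbb N$ let $\Delta^l_{t_j,j}$ be the $l$-th difference operator with step $t_j$ in the variable $x_j$ (the $l$-th power of $f\mapsto f(\dots,x_j+t_j,\dots)-f(\dots,x_j,\dots)$). For a subset $e\subset\{1,\dots,d\}$ let $\Delta^l_{\mathbf t}(e):=\prod_{j\in e}\Delta^l_{t_j,j}$, and $\Delta^l_{\mathbf t}(\varnothing)$ is the identity operator. Put $l:=[r]+1$, where $[r]$ is the integer part of $r$. The class $\mathbf H^r_\infty$ is the set of all $f\in L_\infty(\mathbb T^d)$ such that for every $e\subset\{1,\dots,d\}$ and every $\mathbf t$ $$\|\Delta^l_{\mathbf t}(e)f\|_\infty\le\prod_{j\in e}|t_j|^r .$$ The functions in $\mathbf H^r_\infty$ are continuous (after modification on a null set), and function values refer to the continuous representative. Optimal nonlinear sampling recovery. For a class $W$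 of continuous functions on $\mathbb T^d$, $$\varrho_m^o(W,L_p):=\inf_{\xi}\inf_{\mathcal M}\sup_{f\in W}\|f-\mathcal M(f(\xi^1),\dots,f(\xi^m))\|_p,$$ where $\mathcal M$ ranges over all (arbitrary, not necessarily linear) mappings $\mathcal M:\mathbb C^m\to L_p(\mathbb T^d)$ and $\xi$ ranges over all subsets $\{\xi^1,\dots,\xi^m\}$ of $m$ points in $\mathbb T^d$. *)

(* Defs.v *)
From HB Require Import structures.
From mathcomp Require Import all_boot all_order all_algebra.
From mathcomp Require Import complex.
From mathcomp Require Import all_classical all_reals all_analysis.

Set Implicit Arguments.
Unset Strict Implicit.
Unset Printing Implicit Defensive.

Import Order.TTheory GRing.Theory Num.Theory.
Import numFieldNormedType.Exports.

Local Open Scope classical_set_scope.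
Local Open Scope ring_scope.

(* Product measure mu^n on n-tuples (with the product sigma-algebra): the image
   of mu \x mu^(n-1) under (a, x) |-> a :: x, starting from the unit mass on
   the one-point space of 0-tuples. *)
Section tuple_measure_cons.
Context dT (T : measurableType dT) (R : realType) (n : nat).
Variable m1 : {sigma_finite_measure set T -> \bar R}.
Variable m2 : {sigma_finite_measure set (n.-tuple T) -> \bar R}.

Definition tcons (p : T * n.-tuple T) : n.+1.-tuple T := [tuple of p.1 :: p.2].

Definition tuncons (x : n.+1.-tuple T) : T * n.-tuple T :=
  (thead x, [tuple of behead x]).

Lemma tconsK : cancel tcons tuncons.
Proof.
by move=> [a x]; rewrite /tuncons theadE; congr pair; apply/val_inj.
Qed.

Lemma measurable_tcons : measurable_fun [set: T * n.-tuple T] tcons.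
Proof. exact: (@measurable_cons _ _ _ T fst n snd). Qed.

Lemma measurable_tuncons : measurable_fun [set: n.+1.-tuple T] tuncons.
Proof.
apply/measurable_fun_pairP; split; first exact: measurable_tnth.
exact: measurable_behead.
Qed.

Definition tuple_measure_cons : set (n.+1.-tuple T) -> \bar R :=
  pushforward (m1 \x m2)%E tcons.

Let tuple_measure_cons0 : tuple_measure_cons set0 = 0%E.
Proof. by rewrite /tuple_measure_cons /pushforward preimage_set0 measure0. Qed.

Let tuple_measure_cons_ge0 A : (0 <= tuple_measure_cons A)%E.
Proof. exact: (measure_ge0 (m1 \x m2)%E). Qed.

Let tuple_measure_cons_sigma_additive : semi_sigma_additive tuple_measure_cons.
Proof.
exact: (@measure_semi_sigma_additive _ _ _
  (measure_function_pushforward__canonical__measure_function_Measure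
     (m1 \x m2)%E measurable_tcons)).
Qed.

HB.instance Definition _ := isMeasure.Build _ _ _ tuple_measure_cons
  tuple_measure_cons0 tuple_measure_cons_ge0 tuple_measure_cons_sigma_additive.

Let tuple_measure_cons_sigma_finite : sigma_finite setT tuple_measure_cons.
Proof.
have /sigma_finiteP[F [TF ndF Foo]] := sigma_finiteT m1.
have /sigma_finiteP[G [TG ndG Goo]] := sigma_finiteT m2.
exists (fun k => tuncons @^-1` (F k `*` G k)).
  rewrite -preimage_bigcup (_ : \bigcup_k _ = setT) ?preimage_setT//.
  rewrite -setXTT TF TG predeqE => -[x y]; split.
    by move=> [k _ []/= ? ?]; split; exists k.
  move=> [/= [k _ Fkx] [l _ Gly]]; exists (maxn k l) => //; split.
  - by move: x Fkx; exact/subsetPset/ndF/leq_maxl.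
  - by move: y Gly; exact/subsetPset/ndG/leq_maxr.
move=> k; have [mF Fk] := Foo k; have [mG Gk] := Goo k; split.
  rewrite -[X in measurable X]setTI; apply: measurable_tuncons => //.
  exact: measurableX.
rewrite /tuple_measure_cons /pushforward -comp_preimage.
rewrite (_ : tuncons \o tcons = id); last first.
  by apply/funext => p; exact: tconsK.
by rewrite preimage_id product_measure1E// lte_mul_pinfty// ge0_fin_numE.
Qed.

HB.instance Definition _ := Measure_isSigmaFinite.Build _ _ _
  tuple_measure_cons tuple_measure_cons_sigma_finite.

End tuple_measure_cons.

Fixpoint tuple_measure dT (T : measurableType dT) (R : realType)
    (mu : {sigma_finite_measure set T -> \bar R}) (n : nat) :
    {sigma_finite_measure set (n.-tuple T) -> \bar R} :=
  match n with
  | 0 => \d_([tuple] : 0.-tuple T)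
  | n'.+1 => tuple_measure_cons mu (tuple_measure mu n')
  end.

Definition lebesgueRn (R : realType) (d : nat) :
    {sigma_finite_measure set (d.-tuple (measurableTypeR R)) -> \bar R} :=
  tuple_measure (@lebesgue_measure R) d.

Section torus.
Context (R : realType) (d : nat).
Local Notation C := R[i].
Implicit Types (f g : d.-tuple R -> C) (W : set (d.-tuple R -> C)).

Definition torus : set (d.-tuple R) :=
  [set x | forall i, tnth x i \in `[0, 2 * pi]].

Definition cabs (z : C) : R := Normc.normc z.

Definition L1norm f : \bar R :=
  ((((2 * pi) ^+ d)^-1)%:E * \int[lebesgueRn R d]_(x in torus) (cabs (f x))%:E)%E.

Definition sup_norm f : \bar R := ereal_sup [set (cabs (f x))%:E | x in torus].

(* Elements of L_1 are represented by functions; only their values on the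
   torus matter. *)
Definition L1 : set (d.-tuple R -> C) :=
  [set g | (lebesgueRn R d).-integrable torus (fun x => (complex.Re (g x))%:E) /\
           (lebesgueRn R d).-integrable torus (fun x => (complex.Im (g x))%:E)].

Definition translate (t : R) (j : 'I_d) (x : d.-tuple R) : d.-tuple R :=
  [tuple tnth x i + (if i == j then t else 0) | i < d].

Definition periodic_2pi f := forall j x, f (translate (2 * pi) j x) = f x.

(* R^d carries its topology as 'rV[R]_d, and C is identified with R^2. *)
Definition continuousRn f :=
  let F (v : 'rV[R]_d) := f [tuple v ord0 i | i < d] in
  continuous (fun v => complex.Re (F v)) /\ continuous (fun v => complex.Im (F v)).

Definition difference (t : R) (j : 'I_d) f : d.-tuple R -> C :=
  fun x => f (translate t j x) - f x.

(* The operators for different coordinates commute, so the order of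
   composition is irrelevant. *)
Definition mixed_diff (l : nat) (t : d.-tuple R) (e : {set 'I_d}) :
    (d.-tuple R -> C) -> (d.-tuple R -> C) :=
  \big[comp/id]_(j in e) iter l (difference (tnth t j) j).

(* The elements of H^r_oo, classes modulo null sets in L_oo, are given by their
   continuous representatives, for which sup_norm is the L_oo norm; e = set0
   bounds sup_norm f, so that f is in L_oo.  Num.truncn is the integer part. *)
Definition Hclass (r : R) : set (d.-tuple R -> C) :=
  [set f | [/\ periodic_2pi f, continuousRn f &
    forall (e : {set 'I_d}) (t : d.-tuple R),
      (sup_norm (mixed_diff (Num.truncn r).+1 t e f)
        <= (\prod_(j in e) `|tnth t j| `^ r)%:E)%E]].

(* The points are listed without repetition; M absorbs their order. *)
Definition sampling_points (m : nat) : set (m.-tuple (d.-tuple R)) :=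
  [set xi : m.-tuple (d.-tuple R) | uniq xi /\ forall k, torus (tnth xi k)].

Definition recovery_maps (m : nat) : set (m.-tuple C -> (d.-tuple R -> C)) :=
  [set M | forall y, L1 (M y)].

Arguments sampling_points m : clear implicits.
Arguments recovery_maps m : clear implicits.

Definition recovery_error (m : nat) W (xi : m.-tuple (d.-tuple R))
    (M : m.-tuple C -> (d.-tuple R -> C)) : \bar R :=
  ereal_sup
    [set L1norm (fun x => f x - M [tuple f (tnth xi k) | k < m] x) | f in W].

Definition rho_o (m : nat) W : \bar R :=
  ereal_inf [set ereal_inf [set recovery_error W xi M | M in recovery_maps m]
            | xi in sampling_points m].

End torus.

Arguments torus R d : clear implicits.
Arguments L1 R d : clear implicits.
Arguments Hclass R d r : clear implicits.
Arguments sampling_points R d m : clear implicits.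
Arguments recovery_maps R d m : clear implicits.

(* Main.v *)
Require Import Defs.
From mathcomp Require Import all_boot all_order all_algebra.
From mathcomp Require Import complex.
From mathcomp Require Import all_classical all_reals all_analysis.
From mathcomp Require Import measurable_realfun ring lra zify.

(** Since both [f] and [- f] may be sampled, it suffices to find, for any [m]
    points, a nonnegative function of the class that vanishes at these points
    and has a large integral: on it every recovery map sees only zeros, and its
    single answer is bad for [f] or for [- f] ([L1norm_two_signs]).

    Choose [n] with [2 m <= 2 ^ n <= 4 m]. For every vector of scales [s] with
    [s_1 + ... + s_d = n] cut the torus into [2 ^ n] dyadic boxes with side
    lengths [2 pi / 2 ^ s_j]. At least half of them contain no sampling point;
    put on each of these a tensor product bump of height about [2 ^ (- r n)],
    and add everything up, over all boxes and all vectors [s]. For one [s] the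
    integral is of order [2 ^ (- r n)]; nothing cancels, and there are about
    [n ^ (d - 1)] vectors [s], so the integral of the sum is of order
    [m ^ (- r) (log m) ^ (d - 1)] ([integral_fooling_ge]).

    The sum stays in the class, up to a constant factor independent of [m]
    ([tensor_sum_Hclass]). The height factors as the product of the
    [2 ^ (- r s_j)], so after dropping the constraint on [s] and the selection
    of boxes a mixed difference of the sum is dominated by a product over the
    coordinates of one-dimensional sums. At scale [s] the [l]-th differences
    with step [t] of all bumps sum to at most a constant times
    [min 1 ((2 ^ s t) ^ l)], because a difference of order [l] meets only
    [l + 1] of the disjoint supports ([sum_iter_dif_cell]). As [0 < r < l],
    the series of [2 ^ (- r s) min 1 ((2 ^ s t) ^ l)] is of order [t ^ r]
    ([dyadic_sum_le]). *)

Set Implicit Arguments.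
Unset Strict Implicit.
Unset Printing Implicit Defensive.

Import Order.TTheory GRing.Theory Num.Theory.
Import numFieldNormedType.Exports.

Local Open Scope classical_set_scope.
Local Open Scope ring_scope.
Local Open Scope complex_scope.

(** * Iterated differences of one variable and the basic bump *)

Section differences.
Context (R : realType).
Implicit Types (g h : R -> R) (t u a b : R).

Definition dif t g : R -> R := fun u => g (u + t) - g u.

(** An iterated difference only sees the [l.+1] nodes [u + i t]; this is what
    lets a periodic function be replaced by finitely many translates of a
    bump. *)
Lemma iter_dif_ext l t g h u :
  (forall i, (i <= l)%N -> g (u + i%:R * t) = h (u + i%:R * t)) ->
  iter l (dif t) g u = iter l (dif t) h u.
Proof.
elim: l u => [|l IH] u gh; first by have := gh 0 isT; rewrite mul0r addr0.
rewrite /= /dif (IH u) => [|i il]; last exact/gh/leqW.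
rewrite IH// => i il; have := gh i.+1 il.
by rewrite mulrSr mulrDl mul1r (addrC (_ * t)) addrA.
Qed.

Lemma iter_dif_affine l t g a b u :
  iter l (dif t) (fun v => g (a * v + b)) u = iter l (dif (a * t)) g (a * u + b).
Proof.
elim: l u => [//|l IH] u; rewrite /= /dif !IH.
by have -> : a * (u + t) + b = a * u + b + a * t by ring.
Qed.

Lemma iter_dif_sum l t (I : Type) (s : seq I) (c : I -> R) (g : I -> R -> R) u :
  iter l (dif t) (fun v => \sum_(i <- s) c i * g i v) u =
  \sum_(i <- s) c i * iter l (dif t) (g i) u.
Proof.
elim: l u => [//|l IH] u; rewrite /= /dif !IH -sumrB.
by apply: eq_bigr => i _; rewrite mulrBr.
Qed.

Lemma iter_dif_le_sup l t g u :
  (forall v, `|g v| <= 1) -> `|iter l (dif t) g u| <= 2 ^+ l.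
Proof.
move=> g1; elim: l u => [|l IH] u; first by rewrite expr0 g1.
rewrite /= /dif exprS mulr_natl mulr2n.
by apply: le_trans (ler_normB _ _) _; rewrite lerD.
Qed.

Lemma is_derive_iter_dif l t g g' :
  (forall u, is_derive u 1 g (g' u)) ->
  forall u, is_derive u 1 (iter l (dif t) g) (iter l (dif t) g' u).
Proof.
move=> dg; elim: l => [//|l IH] u /=; rewrite /dif.
have H := IH u.
have H1 : is_derive u 1 (fun v => iter l (dif t) g (v + t)) (iter l (dif t) g' (u + t)).
  have := IH (u + t) => H1.
  have H2 : is_derive u 1 (fun v : R => v + t) 1.
    by apply: is_derive_eq; rewrite addr0.
  have := @is_derive1_comp _ (iter l (dif t) g) (fun v : R => v + t) u _ _ H1 H2.
  by rewrite mulr1.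
exact: is_deriveB.
Qed.

(** One difference is traded for one derivative by the mean value theorem,
    applied to the [l]-th difference of [g], whose derivative is the [l]-th
    difference of [g']. *)
Lemma iter_difS_le l t g g' M :
  (forall u, is_derive u 1 g (g' u)) ->
  (forall u, `|iter l (dif t) g' u| <= M) ->
  forall u, `|iter l.+1 (dif t) g u| <= M * `|t|.
Proof.
move=> dg gM u.
have dG := is_derive_iter_dif l t dg.
have cG (A : set R) : {within A, continuous (iter l (dif t) g)}.
  apply: continuous_subspaceT => x.
  by apply: differentiable_continuous; apply/derivable1_diffP; apply: ex_derive.
rewrite /= {1}/dif; have [t0|t0|<-] := ltgtP 0 t.
- have ut : u < u + t by rewrite ltrDl.
  have [c _ ->] := MVT ut (fun x _ => dG x) (cG _).
  by rewrite normrM addrAC subrr add0r ler_wpM2r.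
- have ut : u + t < u by rewrite gtrDl.
  have [c _] := MVT ut (fun x _ => dG x) (cG _).
  rewrite -normrN opprB => ->.
  by rewrite normrM opprD addrA subrr add0r normrN ler_wpM2r.
- by rewrite addr0 subrr normr0 mulr0.
Qed.

Definition pospart u : R := Num.max u 0.

(** Away from [0] the function is locally a monomial or zero. At [0] it
    factors as [pospart v ^+ n.+1 * v], whose first factor is continuous and
    vanishes there: this is Caratheodory's form of differentiability. *)
Lemma is_derive_pospart_exp n u :
  is_derive u 1 (fun v => pospart v ^+ n.+2) (n.+2%:R * pospart u ^+ n.+1).
Proof.
have [u0|u0|<-] := ltgtP 0 u.
- apply: (@near_eq_is_derive R R^o R^o (fun v => v ^+ n.+2)).
    near=> v; rewrite /pospart max_l// ltW//; near: v.
    exact: lt_nbhsr.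
  rewrite /pospart max_l ?ltW//.
  have := @is_deriveX _ _ (@id R) n.+2 u 1 1 (is_derive_id _ _).
  by rewrite -[_ *: 1]/(_ * 1) mulr1 exprfctE.
- apply: (@near_eq_is_derive R R^o R^o (cst 0)).
    near=> v; rewrite /pospart max_r ?expr0n// ltW//; near: v.
    exact: lt_nbhsl.
  rewrite /pospart max_r ?ltW// expr0n mulr0; exact: is_derive_cst.
- apply/is_derive1_caratheodory; exists (fun v => pospart v ^+ n.+1); split.
  + move=> v; rewrite /pospart maxxx expr0n !subr0 exprS mulrC.
    by case: (leP v 0) => // v0; rewrite expr0n !mul0r.
  + have cp : continuous (pospart : R -> R^o).
      by move=> x; apply: continuous_max; [exact: cvg_id|exact: cvg_cst].
    by apply: (@continuous_comp _ _ _ pospart (fun y => y ^+ n.+1));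
      [exact: cp|exact: exprn_continuous].
  + by rewrite /pospart maxxx expr0n mulr0.
Unshelve. all: by end_near. Qed.

(** A piecewise polynomial, supported in [[0, 1]] for positive exponents.
    Keeping the two exponents apart makes the family stable under
    differentiation, which drives the induction in [iter_dif_bump]. *)
Definition bump (a b : nat) u : R := pospart u ^+ a * pospart (1 - u) ^+ b.

Lemma is_derive_bump (a b : nat) u :
  is_derive u 1 (bump a.+2 b.+2)
    (a.+2%:R * bump a.+1 b.+2 u - b.+2%:R * bump a.+2 b.+1 u).
Proof.
have d1 := is_derive_pospart_exp a u.
have d2 : is_derive u 1 (fun v => pospart (1 - v) ^+ b.+2)
    (- (b.+2%:R * pospart (1 - u) ^+ b.+1)).
  have H1 := is_derive_pospart_exp b (1 - u).
  have H2 : is_derive u 1 (fun v : R => 1 - v) (- 1).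
    by apply: is_derive_eq; rewrite add0r mul1r.
  have := @is_derive1_comp _ (fun v => pospart v ^+ b.+2)
    (fun v : R => 1 - v) u _ _ H1 H2.
  by rewrite mulrN1.
suff e : pospart u ^+ a.+2 *: - (b.+2%:R * pospart (1 - u) ^+ b.+1) +
    pospart (1 - u) ^+ b.+2 *: (a.+2%:R * pospart u ^+ a.+1) =
    a.+2%:R * bump a.+1 b.+2 u - b.+2%:R * bump a.+2 b.+1 u.
  by rewrite -e; exact: (is_deriveM d1 d2).
by rewrite /bump -![_ *: _]/(_ * _); ring.
Qed.

Lemma pospart_ge0 u : 0 <= pospart u.
Proof. by rewrite le_max lexx orbT. Qed.

Lemma bump_ge0 (a b : nat) u : 0 <= bump a b u.
Proof. by rewrite mulr_ge0// exprn_ge0// pospart_ge0. Qed.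

Lemma bump_eq0 (a b : nat) u : u <= 0 \/ 1 <= u -> bump a.+1 b.+1 u = 0.
Proof.
rewrite /bump /pospart => -[u0|u1].
  by rewrite (max_r u0) expr0n mul0r.
by rewrite [Num.max (1 - u) _]max_r ?subr_le0// expr0n mulr0.
Qed.

Lemma bump_le1 (a b : nat) u : bump a.+1 b.+1 u <= 1.
Proof.
have [u0|u0] := leP u 0; first by rewrite bump_eq0//; left.
have [u1|u1] := leP 1 u; first by rewrite bump_eq0//; right.
by rewrite /bump mulr_ile1// ?exprn_ge0 ?pospart_ge0// exprn_ile1 ?pospart_ge0//
  /pospart ge_max ler01 andbT; lra.
Qed.

(** Each derivative lowers one exponent by one and costs a factor at most
    [a + b], so [l] mean value steps are possible while both exponents stay above
    [l]. *)
Lemma iter_dif_bump l (a b : nat) t u : (l < a)%N -> (l < b)%N ->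
  `|iter l (dif t) (bump a b) u| <= ((a + b)%:R * `|t|) ^+ l.
Proof.
elim: l a b u => [|l IH] [|a] [|b] // u la lb.
  by rewrite expr0 /= ger0_norm ?bump_ge0 ?bump_le1.
case: a b la lb => [|a] [|b] // la lb.
rewrite (exprSr _ l) mulrA.
apply: iter_difS_le (is_derive_bump a b) _ _ => {}u.
have -> : (fun v => a.+2%:R * bump a.+1 b.+2 v - b.+2%:R * bump a.+2 b.+1 v) =
   (fun v => \sum_(i <- [:: true; false]) (if i then a.+2%:R else - b.+2%:R) *
      (if i then bump a.+1 b.+2 else bump a.+2 b.+1) v).
  by apply/funext => v; rewrite !big_cons big_nil addr0 mulNr.
rewrite iter_dif_sum !big_cons big_nil addr0.
have H1 := IH a.+1 b.+2 u la (ltnW lb).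
have H2 := IH a.+2 b.+1 u (ltnW la) lb.
apply: le_trans (ler_normD _ _) _.
rewrite !normrM normrN !normr_nat natrD mulrDr lerD//.
all: rewrite mulrC ler_wpM2r ?ler0n//; apply: le_trans.
all: try apply: H1; try apply: H2.
all: apply: lerXn2r; rewrite ?nnegrE ?mulr_ge0 ?ler0n// ler_wpM2r//
  -natrD ler_nat; lia.
Qed.

End differences.

(** * Periodic cells *)

Section cells.
Context (R : realType).
Implicit Types (t u : R).

Lemma iter_dif_bump_min l L t u : (l < L)%N ->
  `|iter l (dif t) (bump L L) u| <= (L + L)%:R ^+ l * Num.min 1 (`|t| ^+ l).
Proof.
move=> lL; rewrite minr_pMr ?exprn_ge0// mulr1 le_min -exprMn iter_dif_bump// andbT.
apply: le_trans (iter_dif_le_sup _ _ _ _) _ => [v|].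
  by case: L lL => // L _; rewrite ger0_norm ?bump_ge0 ?bump_le1.
by apply: lerXn2r; rewrite ?nnegrE ?ler0n// ler_nat; lia.
Qed.

(** The copy of the bump on the intervals [[k, k + 1]] modulo [N]: an
    [N]-periodic function that vanishes on all other unit intervals, and
    identically when [k >= N] and [N > 0]. *)
Definition cell (L N k : nat) u : R :=
  ((Num.floor u %% N%:Z)%Z == k%:Z)%:R * bump L L (u - (Num.floor u)%:~R).

Lemma bump_off_floor L u (q : int) : q != Num.floor u ->
  bump L.+1 L.+1 (u - q%:~R) = 0.
Proof.
move=> qu; apply: bump_eq0; have := floor_itv u; have [qf|qf] := ltP q (Num.floor u).
  move=> /andP[+ _]; right.
  have : (q + 1)%:~R <= (Num.floor u)%:~R :> R by rewrite ler_int; lia.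
  by rewrite rmorphD/=; lra.
move=> /andP[_ +]; left.
have : (Num.floor u + 1)%:~R <= q%:~R :> R by rewrite ler_int; lia.
lra.
Qed.

Lemma cell_periodic L N k u : cell L N k (u + N%:R) = cell L N k u.
Proof.
have -> : N%:R = N%:Z%:~R :> R by [].
rewrite /cell floorDrz ?intr_int// intrKfloor modzDr rmorphD/=.
by congr (_ * bump _ _ _); ring.
Qed.

Lemma cell_ge0 L N k u : 0 <= cell L N k u.
Proof. by rewrite mulr_ge0// bump_ge0. Qed.

(** On finitely many nodes the floor function takes finitely many values, and
    there a cell is a linear combination of integer translates of the bump;
    unlike the cell itself these have a global formula to which
    [iter_dif_bump] applies. The affine shape of the argument is the one of
    [iter_dif_affine]. *)
Lemma cell_sumE L N k u (Q : seq int) : uniq Q -> Num.floor u \in Q ->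
  cell L.+1 N k u =
  \sum_(q <- Q) ((q %% N%:Z)%Z == k%:Z)%:R * bump L.+1 L.+1 (1 * u + - q%:~R).
Proof.
move=> uQ uin; rewrite (bigD1_seq (Num.floor u))//= big1 ?addr0 ?mul1r// => q qu.
by rewrite bump_off_floor// mulr0.
Qed.

(** The [l.+1] nodes of a difference meet at most [l.+1] unit intervals, and
    each of these belongs to a single cell. Hence only [l.+1] translates of
    the bump contribute to the whole sum over [k]. *)
Lemma sum_iter_dif_cell l L N K t u M :
  (forall v, `|iter l (dif t) (bump L.+1 L.+1) v| <= M) ->
  \sum_(k < K) `|iter l (dif t) (cell L.+1 N k) u| <= l.+1%:R * M.
Proof.
move=> bM.
(* The unit intervals met by the nodes of the difference. *)
pose Q := undup [seq Num.floor (u + i%:R * t) | i <- iota 0 l.+1].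
have Qu : uniq Q by exact: undup_uniq.
have sQ : (size Q <= l.+1)%N.
  by apply: leq_trans (size_undup _) _; rewrite size_map size_iota.
have M0 : 0 <= M by apply: le_trans (bM 0).
have dE k : iter l (dif t) (cell L.+1 N k) u = \sum_(q <- Q)
    ((q %% N%:Z)%Z == k%:Z)%:R * iter l (dif t) (bump L.+1 L.+1) (1 * u - q%:~R).
  rewrite (@iter_dif_ext _ _ _ _ (fun v => \sum_(q <- Q) ((q %% N%:Z)%Z == k%:Z)%:R *
    bump L.+1 L.+1 (1 * v + - q%:~R))).
    rewrite iter_dif_sum; apply: eq_bigr => q _.
    by rewrite iter_dif_affine mul1r.
  move=> i il; apply: cell_sumE => //; rewrite mem_undup.
  by apply: (map_f (fun i => Num.floor (u + i%:R * t))); rewrite mem_iota.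
apply: (@le_trans _ _ (\sum_(k < K) \sum_(q <- Q) ((q %% N%:Z)%Z == k%:Z)%:R * M)).
  apply: ler_sum => k _; rewrite dE; apply: le_trans (ler_norm_sum _ _ _) _.
  by apply: ler_sum => q _; rewrite normrM ger0_norm// ler_wpM2l.
rewrite exchange_big/=.
apply: (@le_trans _ _ (\sum_(q <- Q) M)).
  apply: ler_sum => q _; rewrite -mulr_suml ler_piMl//.
  have [/existsP[k0 /eqP qk]|] := boolP [exists k : 'I_K, (q %% N%:Z)%Z == k%:Z].
    rewrite (bigD1 k0)//= qk eqxx big1 ?addr0// => k kk.
    by rewrite eqz_nat eq_sym val_eqE (negbTE kk).
  rewrite negb_exists => /forallP qk; rewrite big1// => k _.
  by rewrite (negbTE (qk k)).
by rewrite big_const_seq count_predT iter_addr_0 -[M *+ _]mulr_natl ler_wpM2r// ler_nat.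
Qed.

Lemma sum_cell_le1 L N K u : \sum_(k < K) `|cell L.+1 N k u| <= 1.
Proof.
have := @sum_iter_dif_cell 0 L N K 0 u 1; rewrite mulr1; apply=> v.
by rewrite /= ger0_norm ?bump_ge0 ?bump_le1.
Qed.

(** Cells are Lipschitz, by the estimate of first order differences. *)
Lemma continuous_cell L N k : continuous (cell L.+2 N k : R -> R^o).
Proof.
have lip t u : `|cell L.+2 N k (u + t) - cell L.+2 N k u| <=
    (2 * (L.+2 + L.+2))%:R * `|t|.
  have bl v : `|iter 1 (dif t) (bump L.+2 L.+2) v| <= (L.+2 + L.+2)%:R * `|t|.
    by have := @iter_dif_bump _ 1 L.+2 L.+2 t v isT isT; rewrite expr1.
  have := @sum_iter_dif_cell 1 L.+1 N k.+1 t u _ bl.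
  rewrite mulrA -natrM; apply: le_trans.
  by rewrite big_ord_recr/= -[leLHS]add0r lerD2r sumr_ge0.
move=> u; apply/cvgrPdist_lt => e e0.
have K0 : 0 < (2 * (L.+2 + L.+2))%:R :> R by rewrite ltr0n.
near=> v; rewrite distrC -[v](subrKC u); apply: le_lt_trans (lip _ _) _.
rewrite mulrC -ltr_pdivlMr// distrC; near: v.
by apply: (@cvgr_dist_lt _ _ _ (nbhs u) _ id u); rewrite ?divr_gt0//; exact: cvg_id.
Unshelve. all: by end_near. Qed.

End cells.

(** * Summation over dyadic scales *)

Section dyadic_summation.
Context (R : realType).
Implicit Types (r t y : R).

(** The left side is [y ^ (l - r)] up to [1] and [y ^ (- r)] beyond, so it is
    at most [min z z^-1], and this is at most the kernel on the right. *)
Lemma min_powR_le_kernel l r y : 0 < r -> r < l%:R -> 0 < y ->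
  let z := y `^ Num.min r (l%:R - r) in
  y `^ (- r) * Num.min 1 (y ^+ l) <= 4 * z / (1 + z) ^+ 2.
Proof.
move=> r0 rl y0; set e := Num.min _ _; set z := _ `^ e; rewrite /=.
have e0 : 0 < e by rewrite /e lt_min r0 subr_gt0.
have z0 : 0 < z by exact: powR_gt0.
have z10 : 0 < (1 + z) ^+ 2 by rewrite exprn_gt0// addr_gt0.
rewrite ler_pdivlMr//; have [y1|y1] := leP y 1.
  have z1 : z <= 1.
    by have := @ge0_ler_powR _ e (ltW e0) y 1; rewrite powR1 !nnegrE; apply=> //; exact: ltW.
  have yz : y `^ (- r) * Num.min 1 (y ^+ l) <= z.
    rewrite min_r ?exprn_ile1// ?(ltW y0)// -powR_mulrn ?(ltW y0)//.
    rewrite -powRD ?(gt_eqF y0) ?implybT// addrC.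
    by apply: ger_powR; rewrite ?y0// ge_min lexx orbT.
  apply: (@le_trans _ _ (z * (1 + z) ^+ 2)); first by rewrite ler_pM2r.
  nra.
have z1 : 1 <= z.
  have := @ge0_ler_powR _ e (ltW e0) 1 y; rewrite powR1 !nnegrE.
  by apply=> //; exact: ltW.
have yz : y `^ (- r) * Num.min 1 (y ^+ l) <= z^-1.
  rewrite min_l ?exprn_ege1 ?(ltW y1)// mulr1 /z -powRN.
  by apply: ler_powR; rewrite ?(ltW y1)// lerN2 ge_min lexx.
apply: (@le_trans _ _ (z^-1 * (1 + z) ^+ 2)); first by rewrite ler_pM2r.
by rewrite mulrC ler_pdivrMr//; nra.
Qed.

(** The kernel is a discrete derivative along [z, q z, q^2 z, ...] of the
    bounded function [z / (1 + z)], so its sum over a geometric progression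
    telescopes. *)
Lemma kernel_le_telescope (q z : R) : 1 < q -> 0 < z ->
  4 * z / (1 + z) ^+ 2 <=
  4 * q / (q - 1) * (q * z / (1 + q * z) - z / (1 + z)).
Proof.
move=> q1 z0; have qz0 : 0 < q * z by rewrite mulr_gt0//; lra.
have -> : 4 * q / (q - 1) * (q * z / (1 + q * z) - z / (1 + z)) =
    4 * q * z / ((1 + q * z) * (1 + z)).
  by field; rewrite !gt_eqF//; lra.
rewrite ler_pdivrMr ?exprn_gt0 ?addr_gt0//.
rewrite mulrAC ler_pdivlMr ?mulr_gt0 ?addr_gt0//.
rewrite -subr_ge0.
have -> : 4 * q * z * (1 + z) ^+ 2 - 4 * z * ((1 + q * z) * (1 + z)) =
  4 * z * (1 + z) * (q - 1) by ring.
by rewrite !mulr_ge0//; lra.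
Qed.

(** The scales with [2 ^ s t] near [1] dominate, and each of them contributes
    about [t `^ r]; the condition [r < l] makes the sum over small [2 ^ s t]
    converge, [0 < r] the sum over large ones. *)
Lemma dyadic_sum_le l r : 0 < r -> r < l%:R ->
  exists2 C, 0 < C & forall n t, 0 <= t ->
    \sum_(s < n) (2 `^ (- r)) ^+ s * Num.min 1 ((2 ^+ s * t) ^+ l) <= C * t `^ r.
Proof.
move=> r0 rl; pose e := Num.min r (l%:R - r).
have e0 : 0 < e by rewrite lt_min r0 subr_gt0.
pose q : R := 2 `^ e.
have q1 : 1 < q.
  have := @gt0_ltr_powR _ e e0 1 2; rewrite powR1 !nnegrE.
  by apply=> //; rewrite ltr1n.
pose C := 4 * q / (q - 1).
have C0 : 0 < C by rewrite divr_gt0//; lra.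
exists C => // n t; rewrite le_eqVlt => /orP[/eqP<-|t0].
  have l0 : (0 < l)%N by case: l rl {e e0 q q1 C C0}=> //; lra.
  rewrite big1 => [|s _]; first exact: mulr_ge0 (ltW C0) (powR_ge0 _ _).
  by rewrite mulr0 expr0n eqn0Ngt l0 /= min_r ?mulr0// ler01.
(* The kernel variable at scale [s], a geometric progression of ratio [q]. *)
pose z s := (2 ^+ s * t) `^ e.
have z0 s : 0 < z s by rewrite powR_gt0// mulr_gt0// exprn_gt0.
have zS s : z s.+1 = q * z s.
  by rewrite /z exprS -mulrA powRM ?mulr_ge0 ?exprn_ge0// ltW.
apply: (@le_trans _ _ (\sum_(s < n) C * t `^ r *
    (z s.+1 / (1 + z s.+1) - z s / (1 + z s)))).
  apply: ler_sum => s _.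
  have y0 : 0 < 2 ^+ s * t by rewrite mulr_gt0// exprn_gt0.
  have -> : (2 `^ (- r)) ^+ s = t `^ r * (2 ^+ s * t) `^ (- r).
    rewrite powRM ?exprn_ge0 ?(ltW t0)// mulrCA -powRD ?(gt_eqF t0) ?implybT//.
    rewrite subrr powRr0 mulr1 -(powR_mulrn s (powR_ge0 _ _)).
    by rewrite (powRAC 2 (- r) s%:R) (powR_mulrn s (ler0n R 2)).
  rewrite -mulrA [C * _]mulrC -[leRHS]mulrA ler_pM2l ?powR_gt0//.
  apply: le_trans (min_powR_le_kernel r0 rl y0) _.
  by rewrite -/e -/(z s) zS; exact: kernel_le_telescope.
rewrite -mulr_sumr ler_piMr//; first exact: mulr_ge0 (ltW C0) (powR_ge0 _ _).
have -> : \sum_(s < n) (z s.+1 / (1 + z s.+1) - z s / (1 + z s)) =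
    z n / (1 + z n) - z 0%N / (1 + z 0%N).
  by rewrite -(big_mkord xpredT
    (fun s => z s.+1 / (1 + z s.+1) - z s / (1 + z s))) telescope_sumr.
have : z n / (1 + z n) <= 1 by rewrite ler_pdivrMr ?mul1r ?lerDr// addr_gt0.
have : 0 <= z 0%N / (1 + z 0%N) by rewrite divr_ge0// ltW// addr_gt0.
lra.
Qed.

End dyadic_summation.

(** * Finite sums of tensor products *)

Section tensor_sums.
Context (R : realType) (d : nat) (I : finType).
Implicit Types (c : I -> R) (g : I -> 'I_d -> R -> R) (x : d.-tuple R).

(** Finite combinations of products of functions of one variable: on these a
    mixed difference acts factor by factor, which reduces the class condition
    to one-dimensional sums. *)
Definition tensor_sum c g x : R := \sum_i c i * \prod_j g i j (tnth x j).

Definition tensor_sumC c g x : R[i] := (tensor_sum c g x)%:C.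

Lemma cabs_real (a : R) : cabs a%:C = `|a|.
Proof. by rewrite /cabs /= expr0n addr0 sqrtr_sqr. Qed.

Lemma difference_tensor_sum t j c g :
  difference t j (tensor_sumC c g) =
  tensor_sumC c (fun i k => if k == j then dif t (g i k) else g i k).
Proof.
apply/funext => x; rewrite /difference /tensor_sumC -rmorphB/= /tensor_sum -sumrB.
congr (_%:C); apply: eq_bigr => i _; rewrite -mulrBr; congr (_ * _).
have prodE (h : 'I_d -> R) : \prod_k h k = h j * \prod_(k | k != j) h k.
  exact: bigD1.
rewrite !prodE eqxx tnth_mktuple eqxx /dif mulrBl.
rewrite [in RHS](eq_bigr (fun k => g i k (tnth x k))); last by move=> k /negbTE ->.
rewrite [in LHS](eq_bigr (fun k => g i k (tnth x k)))// => k /negbTE kj.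
by rewrite tnth_mktuple kj addr0.
Qed.

Lemma iter_difference_tensor_sum l t j c g :
  iter l (difference t j) (tensor_sumC c g) =
  tensor_sumC c (fun i k => if k == j then iter l (dif t) (g i k) else g i k).
Proof.
elim: l => [|l IH] /=.
  by congr tensor_sumC; apply/funext => i; apply/funext => k; rewrite if_same.
rewrite IH difference_tensor_sum; congr tensor_sumC.
by apply/funext => i; apply/funext => k; case: (k == j).
Qed.

Lemma mixed_diff_tensor_sum l (t : d.-tuple R) (e : {set 'I_d}) c g :
  mixed_diff l t e (tensor_sumC c g) =
  tensor_sumC c (fun i k => if k \in e then iter l (dif (tnth t k)) (g i k) else g i k).
Proof.
rewrite /mixed_diff.
suff diffE s : uniq s ->
    (\big[comp/id]_(j <- s | j \in e) iter l (difference (tnth t j) j)) (tensor_sumC c g) =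
    tensor_sumC c (fun i k => if (k \in s) && (k \in e)
      then iter l (dif (tnth t k)) (g i k) else g i k).
  rewrite diffE ?index_enum_uniq//; congr tensor_sumC.
  by apply/funext => i; apply/funext => k; rewrite mem_index_enum.
elim: s => [|j s IH]; first by rewrite big_nil.
rewrite cons_uniq => /andP[js us]; rewrite big_cons.
have [je|je] := boolP (j \in e); last first.
  rewrite IH//; congr tensor_sumC; apply/funext => i; apply/funext => k.
  by rewrite inE; case: eqVneq => [->|]//; rewrite (negbTE je) andbF.
rewrite [LHS]/= IH// iter_difference_tensor_sum; congr tensor_sumC.
apply/funext => i; apply/funext => k; rewrite inE.
by case: eqVneq => [->|]//; rewrite je (negbTE js).
Qed.

(** Distributivity over two nested choices per coordinate: a sum over all
    scales and positions of a product over the coordinates is a product of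
    one-dimensional sums. *)
Lemma sum_prod_pair (S T : finType) (A : 'I_d -> S -> T -> R) :
  \sum_(i : {ffun 'I_d -> S} * {ffun 'I_d -> T}) \prod_j A j (i.1 j) (i.2 j) =
  \prod_j \sum_s \sum_k A j s k.
Proof.
rewrite bigA_distr_bigA/=.
under [RHS]eq_bigr do rewrite bigA_distr_bigA/=.
by rewrite pair_bigA.
Qed.

Lemma cabs_tensor_sum_le c g x :
  cabs (tensor_sumC c g x) <= \sum_i `|c i| * \prod_j `|g i j (tnth x j)|.
Proof.
rewrite cabs_real; apply: le_trans (ler_norm_sum _ _ _) _.
by apply: ler_sum => i _; rewrite normrM normr_prod.
Qed.

Lemma periodic_tensor_sum c g :
  (forall i j u, g i j (u + 2 * pi) = g i j u) -> periodic_2pi (tensor_sumC c g).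
Proof.
move=> gp j x; congr (_%:C); apply: eq_bigr => i _; congr (_ * _).
by apply: eq_bigr => k _; rewrite tnth_mktuple; case: ifP => _; rewrite ?addr0 ?gp.
Qed.

Lemma continuous_tensor_sum c g :
  (forall i j, continuous (g i j : R -> R^o)) -> continuousRn (tensor_sumC c g).
Proof.
move=> gc; split => v /=; last exact: (@cst_continuous _ R^o 0).
apply: (@cvg_big R^o _ _ _ _ _ _ (nbhs v)) => [|i _]; first exact: add_continuous.
apply: cvgM; first exact: cvg_cst.
apply: (@cvg_big R^o _ _ _ _ _ _ (nbhs v)) => [|j _]; first exact: mul_continuous.
rewrite tnth_mktuple; under eq_cvg do rewrite tnth_mktuple.
apply: (@continuous_comp _ _ _ (fun M : 'rV[R]_d => M ord0 j) (g i j)).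
  exact: coord_continuous.
exact: gc.
Qed.

Lemma measurable_tensor_sum c g (D : set (d.-tuple (measurableTypeR R))) :
  (forall i j, measurable_fun [set: measurableTypeR R] (g i j : measurableTypeR R -> R)) ->
  measurable_fun D (tensor_sum c g : d.-tuple (measurableTypeR R) -> R).
Proof.
move=> gm; apply: measurable_sum => i; apply: measurable_funM; first exact: measurable_cst.
apply: measurable_prod => j _.
apply: (measurableT_comp (gm i j)); apply: measurable_funTS; exact: measurable_tnth.
Qed.

End tensor_sums.

(** * Boxes and L1 norms on the torus *)

Section torus_integrals.
Context (R : realType).

Definition box d (a b : 'I_d -> R) : set (d.-tuple (measurableTypeR R)) :=
  [set x | forall i, tnth x i \in `[a i, b i]].

Lemma box_tcons d (a b : 'I_d.+1 -> R) :
  @tcons _ (measurableTypeR R) d @^-1` box a b =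
  `[a ord0, b ord0]%classic `*` box (a \o lift ord0) (b \o lift ord0).
Proof.
apply/seteqP; split => -[y x] /=.
  move=> H; split; first by have := H ord0; rewrite tnth0.
  by move=> i; rewrite /= -(tnthS y x i); exact: H.
move=> [Hy Hx] i; case: (unliftP ord0 i) => [j|] ->; last exact: Hy.
by have := Hx j; rewrite -(tnthS y x j).
Qed.

Lemma measurable_box d (a b : 'I_d -> R) : measurable (box a b).
Proof.
elim: d a b => [|d IH] a b.
  suff -> : box a b = setT by exact: measurableT.
  by apply/seteqP; split => // x _ [].
have -> : box a b = @tuncons _ (measurableTypeR R) d @^-1`
   (`[a ord0, b ord0]%classic `*` box (a \o lift ord0) (b \o lift ord0)).
  rewrite -box_tcons -comp_preimage; apply/seteqP; split => x /=.
    by rewrite /tcons /=; suff -> : [tuple of thead x :: behead x] = x by []; rewrite -tuple_eta.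
  by rewrite /tcons /=; suff -> : [tuple of thead x :: behead x] = x by []; rewrite -tuple_eta.
rewrite -[X in measurable X]setTI; apply: measurable_tuncons => //.
by apply: measurableX => //; exact: IH.
Qed.

(** Induction on the dimension: under [tcons] a box is an interval times a box
    of one dimension less. *)
Lemma lebesgueRn_box d (a b : 'I_d -> R) : (forall i, a i <= b i) ->
  lebesgueRn R d (box a b) = (\prod_i (b i - a i))%:E.
Proof.
elim: d a b => [|d IH] a b ab.
  rewrite big_ord0 /lebesgueRn /= diracE.
  by rewrite mem_set// => -[].
transitivity ((@lebesgue_measure R \x lebesgueRn R d)%E
  (@tcons _ (measurableTypeR R) d @^-1` box a b)).
  by [].
rewrite box_tcons product_measure1E//; last exact: measurable_box.
have itvE : @lebesgue_measure R `[a ord0, b ord0]%classic = (b ord0 - a ord0)%:E.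
  rewrite lebesgue_measure_itv /= lte_fin; case: ltP => [//|ba].
  by have := ab ord0 => ab0; congr EFin; lra.
rewrite big_ord_recl EFinM; congr (_ * _)%E; first exact: itvE.
by apply: IH => i; exact: ab.
Qed.

Lemma torus_box d : torus R d = box (fun=> 0) (fun=> 2 * pi).
Proof. by []. Qed.

Lemma measurable_cabs d (D : set (d.-tuple (measurableTypeR R)))
    (f g : d.-tuple (measurableTypeR R) -> R) :
  measurable_fun D f -> measurable_fun D g ->
  measurable_fun D (fun x => cabs (f x +i* g x)).
Proof.
move=> mf mg; apply: (measurableT_comp (@continuous_measurable_fun R _ (@sqrt_continuous R))).
by apply: measurable_funD; apply: measurable_funX.
Qed.

Lemma ler_Re_cabs (z : R[i]) : `|complex.Re z| <= cabs z.
Proof.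
case: z => a b; rewrite /cabs/= -sqrtr_sqr.
by apply: ler_wsqrtr; rewrite lerDl sqr_ge0.
Qed.

Local Open Scope ereal_scope.

(** Pointwise, the two recovery errors [F - g] and [- F - g] have real parts
    that differ by [2 F]. *)
Lemma integral_le_recovery d (F : d.-tuple (measurableTypeR R) -> R)
    (g : d.-tuple R -> R[i]) :
  measurable_fun (torus R d) F -> (forall x, 0 <= F x)%R -> L1 R d g ->
  \int[lebesgueRn R d]_(x in torus R d) (F x)%:E +
  \int[lebesgueRn R d]_(x in torus R d) (F x)%:E <=
  \int[lebesgueRn R d]_(x in torus R d) (cabs ((F x)%:C - g x))%:E +
  \int[lebesgueRn R d]_(x in torus R d) (cabs ((- F x)%:C - g x))%:E.
Proof.
move=> mF F0 [/measurable_int/measurable_EFinP mRe /measurable_int/measurable_EFinP mIm].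
have mT : measurable (torus R d : set (d.-tuple (measurableTypeR R))).
  by rewrite torus_box; exact: measurable_box.
have mc (G : d.-tuple (measurableTypeR R) -> R) : measurable_fun (torus R d) G ->
    measurable_fun (torus R d) (fun x => (cabs ((G x)%:C - g x))%:E).
  move=> mG; apply/measurable_EFinP.
  have -> : (fun x => cabs ((G x)%:C - g x)%R) =
      (fun x => cabs ((G x - complex.Re (g x)) +i* (0 - complex.Im (g x)))%R).
    by apply/funext => x; case: (g x).
  by apply: measurable_cabs; apply: measurable_funB.
have mF' := mc _ mF; have mNF := mc _ (measurable_funN mF).
have c0 (z : R[i]) : 0 <= (cabs z)%:E by rewrite lee_fin; case: z => a b; exact: sqrtr_ge0.
have FE0 x : torus R d x -> 0 <= (F x)%:E by move=> _; rewrite lee_fin.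
have mFE := (measurable_EFinP _ _).2 mF.
rewrite -!ge0_integralD//.
apply: ge0_le_integral => //.
- by move=> x _; rewrite adde_ge0// lee_fin.
- exact: emeasurable_funD.
- exact: emeasurable_funD.
move=> x _; rewrite -!EFinD lee_fin.
apply: (@le_trans _ _ (`|F x - complex.Re (g x)| + `|- F x - complex.Re (g x)|))%R.
  rewrite -[X in (_ <= _ + X)%R]normrN.
  apply: le_trans (ler_normD _ _); apply: le_trans (ler_norm _).
  by lra.
have ReE (a : R) : complex.Re (a%:C - g x)%R = (a - complex.Re (g x))%R by case: (g x).
by apply: lerD; rewrite -ReE ler_Re_cabs.
Qed.

(** No single [g] approximates both [F] and [- F] better than [0] does; this
    is why a nonnegative function vanishing at the sampling points bounds the
    recovery error from below. *)
Lemma L1norm_two_signs d (F : d.-tuple (measurableTypeR R) -> R)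
    (g : d.-tuple R -> R[i]) (X : R) :
  measurable_fun (torus R d) F -> (forall x, 0 <= F x)%R -> L1 R d g ->
  ((X * (2 * pi) ^+ d)%:E <= \int[lebesgueRn R d]_(x in torus R d) (F x)%:E) ->
  X%:E <= L1norm (fun x => (F x)%:C - g x)%R \/
  X%:E <= L1norm (fun x => (- F x)%:C - g x)%R.
Proof.
move=> mF F0 Lg XF.
have P0 : (0 < (2 * pi) ^+ d :> R)%R by rewrite exprn_gt0// mulr_gt0// pi_gt0.
have toL (h : d.-tuple R -> R[i]) :
    (X * (2 * pi) ^+ d)%:E <= \int[lebesgueRn R d]_(x in torus R d) (cabs (h x))%:E ->
    X%:E <= L1norm h.
  move=> Xh; rewrite /L1norm.
  have -> : X%:E = (((2 * pi) ^+ d)^-1)%:E * (X * (2 * pi) ^+ d)%:E.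
    by rewrite -EFinM mulrCA mulVf ?mulr1// gt_eqF.
  by apply: lee_wpmul2l => //; rewrite lee_fin invr_ge0 ltW.
have [|lt1] := leP (X * (2 * pi) ^+ d)%:E
  (\int[lebesgueRn R d]_(x in torus R d) (cabs ((F x)%:C - g x))%:E).
  by left; exact: toL.
have [|lt2] := leP (X * (2 * pi) ^+ d)%:E
  (\int[lebesgueRn R d]_(x in torus R d) (cabs ((- F x)%:C - g x))%:E).
  by right; exact: toL.
have := lteD lt1 lt2; rewrite ltNge => /negP[].
apply: le_trans (integral_le_recovery mF F0 Lg).
exact: leeD.
Qed.

End torus_integrals.

(** * Dyadic waves on the circle *)

Section waves.
Context (R : realType).
Implicit Types (r t x : R).

Lemma twopi_gt0 : 0 < 2 * pi :> R.
Proof. by rewrite mulr_gt0// pi_gt0. Qed.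

(** The bumps of scale [s] on the circle of length [2 pi]: the index [k] runs
    over the [2 ^ s] dyadic arcs. *)
Definition wave (L s k : nat) x : R := cell L (2 ^ s) k ((2 ^ s)%:R / (2 * pi) * x).

Lemma wave_ge0 L s k x : 0 <= wave L s k x.
Proof. exact: cell_ge0. Qed.

Lemma wave_periodic L s k x : wave L s k (x + 2 * pi) = wave L s k x.
Proof.
rewrite /wave mulrDr [X in _ + X]divfK ?cell_periodic//.
by rewrite gt_eqF// twopi_gt0.
Qed.

Lemma continuous_wave L s k : continuous (wave L.+2 s k : R -> R^o).
Proof.
move=> x; apply: (@continuous_comp _ _ _ (fun x => (2 ^ s)%:R / (2 * pi) * x)
  (cell L.+2 (2 ^ s) k : R -> R^o)).
  exact: mulrl_continuous.
exact: continuous_cell.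
Qed.

Lemma measurable_wave L s k :
  measurable_fun [set: measurableTypeR R]
    (wave L.+2 s k : measurableTypeR R -> R).
Proof. apply: continuous_measurable_fun; exact: continuous_wave. Qed.

Lemma sum_wave_le1 L s K x : \sum_(k < K) `|wave L.+1 s k x| <= 1.
Proof. exact: sum_cell_le1. Qed.

Lemma sum_iter_dif_wave l L s K t x : (l < L.+1)%N ->
  \sum_(k < K) `|iter l (dif t) (wave L.+1 s k) x| <=
  l.+1%:R * ((L.+1 + L.+1)%:R ^+ l * Num.min 1 ((2 ^+ s * (`|t| / (2 * pi))) ^+ l)).
Proof.
move=> lL; set w := (2 ^ s)%:R / (2 * pi) : R.
have w0 : 0 <= w by rewrite divr_ge0// ltW// twopi_gt0.
have dE k : iter l (dif t) (wave L.+1 s k) x =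
    iter l (dif (w * t)) (cell L.+1 (2 ^ s) k) (w * x + 0).
  rewrite -iter_dif_affine; congr (iter l (dif t) _ x).
  by apply/funext => v; rewrite addr0.
under eq_bigr do rewrite dE.
have -> : 2 ^+ s * (`|t| / (2 * pi)) = `|w * t|.
  by rewrite normrM (ger0_norm w0) /w natrX mulrA mulrAC.
by apply: sum_iter_dif_cell => v; exact: iter_dif_bump_min.
Qed.

(** The dyadic arcs of one scale, taken half-open, are disjoint. *)
Lemma wave_support L s k k' x : wave L s k x != 0 -> wave L s k' x != 0 -> k = k'.
Proof.
rewrite /wave /cell !mulf_eq0 !negb_or !pnatr_eq0 !eqb0 !negbK.
by move=> /andP[/eqP-> _] /andP[/eqP[]].
Qed.

(** On the middle half of its arc the bump argument lies in [[1/4, 3/4]],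
    where both of its factors are at least [1/4]. *)
Lemma wave_lower_bound L s k x : (k < 2 ^ s)%N ->
  x \in `[(k%:R + 4^-1) * (2 * pi / 2 ^+ s), (k%:R + 3 / 4) * (2 * pi / 2 ^+ s)] ->
  (16^-1) ^+ L <= wave L s k x.
Proof.
move=> ks; rewrite in_itv/= => /andP[xl xr].
set v := (2 ^ s)%:R / (2 * pi) * x.
have p0 : 0 < 2 * pi / 2 ^+ s :> R by rewrite divr_gt0 ?twopi_gt0// exprn_gt0.
have vE : v = x / (2 * pi / 2 ^+ s) by rewrite invf_div mulrC /v natrX.
have v1 : k%:R + 4^-1 <= v by rewrite vE ler_pdivlMr.
have v2 : v <= k%:R + 3 / 4 by rewrite vE ler_pdivrMr.
have fl : Num.floor v = k%:Z by apply: floor_def; rewrite rmorphD/=; lra.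
rewrite /wave -/v /cell fl modz_small; last by rewrite lez_nat leq0n ltz_nat.
rewrite eqxx mul1r /bump -exprMn /pospart !max_l; try lra.
apply: lerXn2r; rewrite ?nnegrE; try lra; last by nra.
by rewrite mulr_ge0//; lra.
Qed.

(** The one-dimensional estimates behind the class membership: the first
    serves the coordinates outside [e], the second those inside [e]. *)
Definition dyadic_wave_bound l r (K : R) := forall (N M : nat) x,
  (\sum_(s < N) (2 `^ (- r)) ^+ s * \sum_(k < M) `|wave l.+2 s k x| <= K) /\
  (forall t, \sum_(s < N) (2 `^ (- r)) ^+ s *
      \sum_(k < M) `|iter l.+1 (dif t) (wave l.+2 s k) x| <= K * `|t| `^ r).

(** At scale [s] the sum over [k] is at most a constant times
    [min 1 ((2 ^ s t) ^+ l.+1)], so [dyadic_sum_le] gives the second bound;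
    the first one comes from its instance [t = 1], where the minimum is [1]. *)
Lemma exists_dyadic_wave_bound l r : 0 < r -> r < l.+1%:R ->
  exists2 K : R, 0 < K & dyadic_wave_bound l r K.
Proof.
move=> r0 rl; have [C C0 CP] := dyadic_sum_le r0 rl.
pose B : R := l.+2%:R * (l.+2 + l.+2)%:R ^+ l.+1.
have B1 : 1 <= B.
  by rewrite /B -natrX -natrM ler1n muln_gt0 expn_gt0.
exists (B * C) => [|N M x]; first by rewrite mulr_gt0// (lt_le_trans ltr01).
have q0 s : 0 <= (2 `^ (- r)) ^+ s :> R by rewrite exprn_ge0// powR_ge0.
split=> [|t].
  apply: (@le_trans _ _ C); last by rewrite ler_peMl// ltW.
  have := CP N 1 ler01; rewrite powR1 mulr1; apply: le_trans.
  apply: ler_sum => s _; apply: ler_wpM2l => //.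
  by rewrite mulr1 min_l ?sum_wave_le1// !exprn_ege1// ler1n.
have tp0 : 0 <= `|t| / (2 * pi) by rewrite divr_ge0// ltW// twopi_gt0.
apply: (@le_trans _ _ (B * (C * (`|t| / (2 * pi)) `^ r))); last first.
  rewrite -mulrA ler_wpM2l ?(le_trans ler01)//; apply: ler_wpM2l; first exact: ltW.
  apply: ge0_ler_powR; rewrite ?nnegrE// ?(ltW r0)//.
  rewrite ler_pdivrMr ?twopi_gt0// ler_peMr//.
  by have := @pi_ge2 R; lra.
apply: (@le_trans _ _ (B * \sum_(s < N) (2 `^ (- r)) ^+ s *
    Num.min 1 ((2 ^+ s * (`|t| / (2 * pi))) ^+ l.+1))); last first.
  by apply: ler_wpM2l; [exact: le_trans B1|exact: CP].
rewrite mulr_sumr; apply: ler_sum => s _; rewrite mulrCA; apply: ler_wpM2l => //.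
apply: le_trans (sum_iter_dif_wave _ _ _ _ _) _; first exact: ltnSn.
by rewrite mulrA.
Qed.

End waves.

(** * Fooling functions *)

Section fooling_functions.
Context (R : realType) (d n : nat).

(** A wave in [d] variables is indexed by its scales and its positions.
    Positions range over a type independent of the scales, so that sums factor
    over the coordinates; the positions beyond [2 ^ s] carry the zero
    function. *)
Notation wave_index := ({ffun 'I_d -> 'I_n.+1} * {ffun 'I_d -> 'I_(2 ^ n)})%type.
Implicit Types (i : wave_index).

Definition waves (L : nat) i (j : 'I_d) : R -> R := wave L (i.1 j) (i.2 j).

Definition on_level i := (\sum_j i.1 j == n)%N.

(** The coefficients are bounded by a product over the coordinates, so after
    enlarging the sum to all scales and positions it is a product of
    one-dimensional sums. Each factor is at most [K |t_j| ^ r] or [K], and the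
    normalisation [K ^- d] compensates the constants. No logarithmic loss
    appears although a point lies in many dyadic boxes. *)
Lemma tensor_sum_Hclass (r K : R) (c : wave_index -> R) :
  let l := Num.truncn r in
  0 < K -> dyadic_wave_bound l r K ->
  (forall i, `|c i| <= (K ^+ d)^-1 * \prod_j (2 `^ (- r)) ^+ i.1 j) ->
  Hclass R d r (tensor_sumC c (waves l.+2)).
Proof.
move=> l K0 HK cK; split.
- by apply: periodic_tensor_sum => i j u; exact: wave_periodic.
- by apply: continuous_tensor_sum => i j; exact: continuous_wave.
move=> e t; rewrite mixed_diff_tensor_sum; apply: ub_ereal_sup => _ [x _ <-].
rewrite lee_fin; apply: le_trans (cabs_tensor_sum_le _ _ _) _.
pose h j (s : 'I_n.+1) (k : 'I_(2 ^ n)) :=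
  `|(if j \in e then iter l.+1 (dif (tnth t j)) (wave l.+2 s k) else wave l.+2 s k) (tnth x j)|.
have q0 s : 0 <= (2 `^ (- r)) ^+ s :> R by rewrite exprn_ge0// powR_ge0.
apply: (@le_trans _ _ (\sum_(i : wave_index)
    (K ^+ d)^-1 * \prod_j ((2 `^ (- r)) ^+ i.1 j * h j (i.1 j) (i.2 j)))).
  apply: ler_sum => i _; rewrite big_split/= mulrA.
  by apply: ler_wpM2r; [exact: prodr_ge0|exact: cK].
rewrite -mulr_sumr (sum_prod_pair (fun j (s : 'I_n.+1) k => (2 `^ (- r)) ^+ s * h j s k)).
rewrite ler_pdivrMl ?exprn_gt0//.
apply: (@le_trans _ _ (\prod_j (K * (if j \in e then `|tnth t j| `^ r else 1)))); last first.
  by rewrite big_split/= prodr_const card_ord -big_mkcond.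
apply: ler_prod => j _; apply/andP; split.
  by apply: sumr_ge0 => s _; apply: sumr_ge0 => k _; apply: mulr_ge0;
    [exact: q0|exact: normr_ge0].
have [H1 H2] := HK n.+1 (2 ^ n)%N (tnth x j).
under eq_bigr do rewrite -mulr_sumr; rewrite /h.
by case: ifP => _; [exact: H2|rewrite mulr1].
Qed.

Section fooling.
Context (L m : nat) (xi : m.-tuple (d.-tuple R)).

(** For [L > 0] a dyadic box is selected when its interior contains no sampling
    point. *)
Definition misses i :=
  [forall p : 'I_m, \prod_j waves L i j (tnth (tnth xi p) j) == 0].

(** All empty boxes of the hyperbolic layer [s_1 + ... + s_d = n] get the same
    amplitude. *)
Definition fooling_coef (a : R) i : R := if on_level i && misses i then a else 0.

Lemma fooling_eq0 a p : tensor_sum (fooling_coef a) (waves L) (tnth xi p) = 0.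
Proof.
apply: big1 => i _; rewrite /fooling_coef.
by case: ifP => [/andP[_ /forallP/(_ p)/eqP->]|_]; rewrite ?mulr0 ?mul0r.
Qed.

Lemma fooling_ge0 a x : 0 <= a -> 0 <= tensor_sum (fooling_coef a) (waves L) x.
Proof.
move=> a0; apply: sumr_ge0 => i _; rewrite mulr_ge0//.
  by rewrite /fooling_coef; case: ifP.
by apply: prodr_ge0 => j _; exact: wave_ge0.
Qed.

Definition valid i := [forall j, (i.2 j < 2 ^ i.1 j)%N].

Lemma card_valid (s : {ffun 'I_d -> 'I_n.+1}) : (\sum_j s j = n)%N ->
  #|[set k : {ffun 'I_d -> 'I_(2 ^ n)} | valid (s, k)]%SET| = (2 ^ n)%N.
Proof.
move=> sn; rewrite -sum1dep_card big_mkcond/=.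
transitivity (\sum_(k : {ffun 'I_d -> 'I_(2 ^ n)}) \prod_j (k j < 2 ^ s j : nat))%N.
  apply: eq_bigr => k _; rewrite /valid/=; case: ifPn => [/forallP H|].
    by rewrite big1// => j _; rewrite H.
  by rewrite negb_forall => /existsP[j /negbTE kj]; rewrite (bigD1 j)//= kj.
rewrite -(bigA_distr_bigA (fun j (k : 'I_(2 ^ n)) => (k < 2 ^ s j : nat)))/=.
transitivity (2 ^ \sum_j s j)%N; last by rewrite sn.
rewrite expn_sum; apply: eq_bigr => j _.
have sj : (2 ^ s j <= 2 ^ n)%N by rewrite leq_pexp2l// -ltnS.
transitivity (\sum_(k < 2 ^ s j) 1)%N; last by rewrite sum1_card card_ord.
rewrite (big_ord_widen _ (fun=> 1%N) sj) [RHS]big_mkcond/=.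
by apply: eq_bigr => k _; case: ltnP.
Qed.

(** For fixed scales a sampling point belongs to at most one half-open box. *)
Lemma card_hit_le (s : {ffun 'I_d -> 'I_n.+1}) : (0 < m)%N ->
  (#|[set k : {ffun 'I_d -> 'I_(2 ^ n)} | ~~ misses (s, k)]%SET| <= m)%N.
Proof.
move=> m0; pose P (k : {ffun 'I_d -> 'I_(2 ^ n)}) (p : 'I_m) :=
  \prod_j waves L (s, k) j (tnth (tnth xi p) j) != 0.
(* A point hitting the box determines the box, so this choice is injective. *)
pose f k := odflt (Ordinal m0) [pick p | P k p].
have fP k : ~~ misses (s, k) -> P k (f k).
  rewrite negb_forall => /existsP[p Pp]; rewrite /f.
  by case: pickP => [//|/(_ p)]; rewrite /P Pp.
rewrite -(@card_in_imset _ _ f).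
  by apply: leq_trans (max_card _) _; rewrite card_ord.
move=> k k'; rewrite !inE => /fP + /fP + ff; rewrite -ff => /prodf_neq0 H /prodf_neq0 H'.
by apply/ffunP => j; apply/val_inj; exact: wave_support (H j isT) (H' j isT).
Qed.

Lemma card_good (s : {ffun 'I_d -> 'I_n.+1}) : (0 < m)%N -> (\sum_j s j = n)%N ->
  (2 ^ n - m <= #|[set k : {ffun 'I_d -> 'I_(2 ^ n)} | valid (s, k) && misses (s, k)]%SET|)%N.
Proof.
move=> m0 sn; rewrite leq_subLR; have := card_valid sn.
set A := [set k | valid _]%SET => cA; set B := [set k | _ && _]%SET.
apply: (@leq_trans #|A|); first by rewrite cA.
rewrite -(cardsID [set k | ~~ misses (s, k)]%SET A); apply: leq_add.
  by apply: leq_trans (card_hit_le s m0); apply: subset_leq_card; exact: subsetIr.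
by apply: subset_leq_card; apply/fintype.subsetP => k; rewrite !inE negbK andbC.
Qed.

Lemma card_levels : (0 < d)%N ->
  #|[set s : {ffun 'I_d -> 'I_n.+1} | (\sum_j s j == n)%N]%SET| = 'C(d.-1 + n, d.-1).
Proof.
move=> d0; rewrite -card_ord_partitions; move: (prednK d0) => E; rewrite {}E.
pose f (t : d.-tuple 'I_n.+1) : {ffun 'I_d -> 'I_n.+1} := [ffun j => tnth t j].
have fK : cancel f (fun s => [tuple s j | j < d]).
  by move=> t; apply: eq_from_tnth => j; rewrite tnth_mktuple ffunE.
rewrite -(card_imset _ (can_inj fK)); apply: eq_card => s; rewrite inE.
apply/idP/imsetP => [sn|[t + ->]].
  exists [tuple s j | j < d]; last by apply/ffunP => j; rewrite ffunE tnth_mktuple.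
  by rewrite inE big_tuple; under eq_bigr do rewrite tnth_mktuple.
by rewrite inE big_tuple; under [X in _ -> X == _]eq_bigr do rewrite ffunE.
Qed.

(** The product of the middle halves of the dyadic arcs, where the tensor wave
    is bounded below. *)
Definition cube i : set (d.-tuple (measurableTypeR R)) :=
  box (fun j => ((i.2 j)%:R + 4^-1) * (2 * pi / 2 ^+ i.1 j))
      (fun j => ((i.2 j)%:R + 3 / 4) * (2 * pi / 2 ^+ i.1 j)).

Lemma cube_sub_torus i : valid i -> cube i `<=` torus R d.
Proof.
move=> /forallP vi x cx j; have := cx j; rewrite !in_itv/= => /andP[x1 x2].
have w0 : 0 < 2 * pi / 2 ^+ i.1 j :> R by rewrite divr_gt0 ?twopi_gt0// exprn_gt0.
apply/andP; split.
  by apply: le_trans x1; rewrite mulr_ge0 ?ltW// addr_ge0.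
apply: le_trans x2 _; rewrite mulrA ler_pdivrMr ?exprn_gt0// mulrC.
rewrite ler_pM2l ?twopi_gt0//.
have : (i.2 j).+1%:R <= (2 ^ i.1 j)%:R :> R by rewrite ler_nat vi.
by rewrite -natr1 natrX; lra.
Qed.

Lemma lebesgueRn_cube i : on_level i ->
  lebesgueRn R d (cube i) = (pi ^+ d / 2 ^+ n)%:E.
Proof.
move=> /eqP ni; rewrite lebesgueRn_box => [|j]; last first.
  rewrite ler_pM2r ?divr_gt0 ?twopi_gt0 ?exprn_gt0//; lra.
congr EFin; transitivity (\prod_j (pi * (2 ^+ i.1 j)^-1) : R).
  by apply: eq_bigr => j _; field; rewrite expf_neq0.
by rewrite big_split/= prodr_const card_ord prodfV prodrXr ni.
Qed.

Definition good i := [&& on_level i, valid i & misses i].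

Lemma card_good_pairs : (0 < d)%N -> (0 < m)%N ->
  ('C(d.-1 + n, d.-1) * (2 ^ n - m) <= #|[pred i | good i]|)%N.
Proof.
move=> d0 m0; rewrite -(card_levels d0).
have -> : #|[pred i | good i]| =
    (\sum_(s : {ffun 'I_d -> 'I_n.+1} | (\sum_j s j == n)%N)
      \sum_(k : {ffun 'I_d -> 'I_(2 ^ n)} | valid (s, k) && misses (s, k)) 1)%N.
  by rewrite pair_big_dep -sum1_card; apply: eq_bigl => -[s k].
rewrite -sum_nat_const; under eq_bigl do rewrite inE.
apply: leq_sum => s /eqP sn.
by rewrite sum1dep_card card_good.
Qed.

Lemma cubes_le_fooling (a : R) x : 0 <= a ->
  \sum_i (if good i then a * ((16^-1) ^+ L) ^+ d else 0) * \1_(cube i) x <=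
  tensor_sum (fooling_coef a) (waves L) x.
Proof.
move=> a0; apply: ler_sum => i _; rewrite /fooling_coef /good.
have pr0 : 0 <= \prod_j waves L i j (tnth x j) by apply: prodr_ge0 => j _; exact: wave_ge0.
case: (on_level i); last by rewrite !mul0r.
case: (boolP (valid i)) => [/forallP vi|_]; last first.
  by rewrite mul0r mulr_ge0//; case: ifP.
case: (misses i); last by rewrite !mul0r.
rewrite /= -mulrA; apply: ler_wpM2l => //; rewrite indicE.
case: (boolP (x \in cube i)) => [|_]; last by rewrite mulr0.
rewrite inE => xcube; rewrite mulr1 -[in leLHS](card_ord d) -prodr_const.
apply: ler_prod => j _; rewrite exprn_ge0//=.
by apply: wave_lower_bound (vi j) _; exact: xcube.
Qed.

End fooling.

Lemma measurable_fooling L m (xi : m.-tuple (d.-tuple R)) a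
    (D : set (d.-tuple (measurableTypeR R))) :
  measurable_fun D (tensor_sum (fooling_coef L.+2 xi a) (waves L.+2)
    : d.-tuple (measurableTypeR R) -> R).
Proof. by apply: measurable_tensor_sum => i j; exact: measurable_wave. Qed.

(** The boxes of one layer all have the same volume. For each of the
    ['C(d.-1 + n, d.-1)] vectors of scales at least [2 ^ n - m] boxes survive, and the
    contributions of different scales add up because every wave is
    nonnegative. *)
Lemma integral_fooling_ge L m (xi : m.-tuple (d.-tuple R)) (a : R) :
  (0 < d)%N -> (0 < m)%N -> 0 <= a ->
  ((a * ((16^-1) ^+ L.+2) ^+ d * (pi ^+ d / 2 ^+ n) *
      ('C(d.-1 + n, d.-1) * (2 ^ n - m))%:R)%:E
   <= \int[lebesgueRn R d]_(x in torus R d)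
        (tensor_sum (fooling_coef L.+2 xi a) (waves L.+2) x)%:E)%E.
Proof.
move=> d0 m0 a0; set v := a * _.
have v0 : 0 <= v by rewrite mulr_ge0// !exprn_ge0.
pose w i : R := if good L.+2 xi i then v else 0.
have w0 i : 0 <= w i by rewrite /w; case: ifP.
have mT : measurable (torus R d : set (d.-tuple (measurableTypeR R))).
  by rewrite torus_box; exact: measurable_box.
have mcube i : measurable (cube i) by exact: measurable_box.
have mind i : measurable_fun (torus R d) (fun x => (w i)%:E * (\1_(cube i) x)%:E)%E.
  apply/measurable_EFinP; apply: measurable_funM; first exact: measurable_cst.
  exact: (measurable_indic (mcube i)).
apply: (@le_trans _ _ (\int[lebesgueRn R d]_(x in torus R d)
    (\sum_i (w i)%:E * (\1_(cube i) x)%:E))%E); last first.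
  apply: ge0_le_integral => //.
  - by move=> x _; apply: sume_ge0 => i _; rewrite mule_ge0// lee_fin.
  - exact: emeasurable_sum.
  - by apply/measurable_EFinP; exact: measurable_fooling.
  - move=> x _; rewrite sumEFin lee_fin; exact: cubes_le_fooling.
rewrite ge0_integral_sum//; last by move=> i x _; rewrite mule_ge0// lee_fin.
rewrite (eq_bigr (fun i => (w i * (pi ^+ d / 2 ^+ n))%:E)).
  rewrite sumEFin lee_fin -mulr_suml [leLHS]mulrAC; apply: ler_wpM2r.
    by rewrite divr_ge0 ?exprn_ge0 ?pi_ge0.
  rewrite -big_mkcond sumr_const -[leRHS]mulr_natr ler_wpM2l// ler_nat.
  exact: card_good_pairs.
move=> i _.
have mi : measurable_fun (torus R d) (fun x => (\1_(cube i) x)%:E : \bar R).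
  by apply/measurable_EFinP; exact: (measurable_indic (mcube i)).
have i0 x : torus R d x -> (0 <= (\1_(cube i) x)%:E :> \bar R)%E by rewrite lee_fin.
rewrite ge0_integralZl_EFin//.
rewrite integral_indic//= /w; case: ifP => [/and3P[li vi _]|_];
  last by rewrite mul0e mul0r.
rewrite (_ : cube i `&` torus R d = cube i) ?lebesgueRn_cube ?EFinM//.
by apply/setIidPl; exact: cube_sub_torus.
Qed.

End fooling_functions.

(** * The lower bound *)

(** The number of scale vectors in a layer supplies the factor [n ^ d.-1],
    which becomes the power of the logarithm. *)
Lemma expn_le_bin_fact (n e : nat) : (n ^ e <= 'C(e + n, e) * e`!)%N.
Proof.
rewrite bin_ffact ffact_prod -[X in (n ^ X <= _)%N]card_ord -prod_nat_const.
by apply: leq_prod => i _; have := ltn_ord i; lia.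
Qed.

Lemma ln_nat_le (R : realType) (m n : nat) : (0 < m)%N -> (m <= 2 ^ n)%N ->
  ln (m%:R : R) <= n%:R.
Proof.
move=> m0 mn; apply: (@le_trans _ _ (ln ((2 ^ n)%:R : R))).
  by rewrite ler_ln ?posrE ?ltr0n ?expn_gt0// ler_nat.
rewrite natrX lnXn// ler_wMn2r//.
by apply: le_trans (@le_ln1Dx R 1 _) _ => //; lra.
Qed.

(** Comparison of the guaranteed integral with the claimed rate when [2 ^ n]
    is comparable to [m]: the amplitude gives [m ^ - r], the number of scale
    vectors gives [ln m ^ e], and at least half of the boxes are empty. *)
Lemma fooling_constants_le (R : realType) (e m n : nat) (r k b : R) :
  0 < r -> 0 <= k -> 0 <= b -> (0 < m)%N -> (2 * m <= 2 ^ n)%N -> (2 ^ n <= 4 * m)%N ->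
  (k * b / 2 ^+ e.+2 * 4 `^ (- r) / (e`!)%:R) * m%:R `^ (- r) * ln m%:R ^+ e
    * (2 * pi) ^+ e.+1
  <= k * (2 `^ (- r)) ^+ n * b * (pi ^+ e.+1 / 2 ^+ n) * ('C(e + n, e) * (2 ^ n - m))%:R.
Proof.
move=> r0 k0 b0 m0 mn nm.
have q : 4 `^ (- r) * m%:R `^ (- r) <= (2 `^ (- r)) ^+ n :> R.
  rewrite -powRM// -(powR_mulrn n (powR_ge0 _ _)) (powRAC 2 (- r) n%:R).
  rewrite (powR_mulrn n (ler0n R 2)) !powRN lef_pV2 ?posrE
     ?powR_gt0 ?mulr_gt0 ?exprn_gt0 ?ltr0n//.
  apply: ge0_ler_powR; rewrite ?nnegrE ?(ltW r0) ?exprn_ge0 ?mulr_ge0//.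
  by rewrite -natrX -natrM ler_nat.
have lnn : ln (m%:R : R) ^+ e <= 'C(e + n, e)%:R * (e`!)%:R.
  apply: (@le_trans _ _ (n%:R ^+ e)); last by rewrite -natrX -natrM ler_nat expn_le_bin_fact.
  apply: lerXn2r; rewrite ?nnegrE// ?ln_ge0 ?ler1n//.
  by apply: ln_nat_le => //; lia.
have half : 2^-1 <= (2 ^ n - m)%:R / 2 ^+ n :> R.
  rewrite ler_pdivlMr ?exprn_gt0// ler_pdivrMl// -natrX -natrM ler_nat; lia.
have f0 : 0 < (e`!)%:R :> R by rewrite ltr0n fact_gt0.
set Q := _ ^+ n in q *; set B := 'C(_, _) in lnn *.
set q0 := _ `^ (- r) in q *; set q1 := _ `^ (- r) in q *.
set lg := _ ^+ e in lnn *.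
have -> : k * b / 2 ^+ e.+2 * q0 / e`!%:R * q1 * lg * (2 * pi) ^+ e.+1 =
  k * b * pi ^+ e.+1 * ((q0 * q1) * (lg / e`!%:R * 2^-1)).
  rewrite [2 ^+ e.+2]exprSr [(2 * pi) ^+ _]exprMn.
  by field; rewrite gt_eqF// expf_neq0.
have -> : k * Q * b * (pi ^+ e.+1 / 2 ^+ n) * (B * (2 ^ n - m))%:R =
  k * b * pi ^+ e.+1 * (Q * (B%:R * ((2 ^ n - m)%:R / 2 ^+ n))).
  by rewrite natrM; field; rewrite expf_neq0.
apply: ler_wpM2l; first by rewrite !mulr_ge0// exprn_ge0// pi_ge0.
have lg0 : 0 <= lg by rewrite exprn_ge0// ln_ge0// ler1n.
apply: ler_pM => //; first by rewrite mulr_ge0 ?powR_ge0.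
  by rewrite mulr_ge0// divr_ge0// ltW.
apply: ler_pM => //; first by rewrite divr_ge0// ltW.
by rewrite ler_pdivrMr.
Qed.

Local Close Scope complex_scope.
Local Close Scope classical_set_scope.

Theorem proposition1p2 (R : realType) (d : nat) (r : R)
    (hd : (0 < d)%N) (hr : 0 < r) :
  exists2 c : R, 0 < c &
    forall m : nat, (2 <= m)%N ->
      ((c * m%:R `^ (- r) * ln m%:R ^+ d.-1)%:E <= rho_o m (Hclass R d r))%E.
Proof.
have [K K0 HK] := exists_dyadic_wave_bound hr (truncnS_gt r).
set L := (Num.truncn r).+2 in HK.
pose k := (K ^+ d)^-1; pose b : R := (16^-1 ^+ L) ^+ d.
have k0 : 0 < k by rewrite invr_gt0 exprn_gt0.
have b0 : 0 < b by rewrite !exprn_gt0.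
exists (k * b / 2 ^+ d.+1 * 4 `^ (- r) / (d.-1`!)%:R).
  rewrite divr_gt0 ?ltr0n ?fact_gt0// mulr_gt0 ?powR_gt0//.
  by rewrite divr_gt0 ?exprn_gt0// mulr_gt0.
move=> m m2; have m0 : (0 < m)%N by lia.
(* Two more than the logarithm, so that each scale vector has at least [2 m] boxes. *)
pose n := (trunc_log 2 m).+2.
have [mn nm] : (2 * m <= 2 ^ n)%N /\ (2 ^ n <= 4 * m)%N.
  have := trunc_log_bounds (isT : (1 < 2)%N) m0.
  by rewrite /n !expnS; lia.
have nb := fooling_constants_le d.-1 hr (ltW k0) (ltW b0) m0 mn nm.
rewrite (prednK hd) in nb.
set X := _ * ln _ ^+ _ in nb *.
apply: le_ereal_inf_tmp => _ [xi [_ _] <-].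
apply: le_ereal_inf_tmp => _ [M LM <-].
pose a := k * (2 `^ (- r)) ^+ n.
have a0 : 0 <= a by rewrite mulr_ge0 ?(ltW k0)// exprn_ge0// powR_ge0.
pose co := @fooling_coef R d n L m xi a.
pose F := tensor_sum co (@waves R d n L).
have coH (c' : _ -> R) : (forall i, `|c' i| = `|co i|) ->
    Hclass R d r (tensor_sumC c' (@waves R d n L)).
  move=> cc'; apply: (tensor_sum_Hclass K0 HK) => i; rewrite cc' /co /fooling_coef.
  have p0 : 0 <= \prod_j (2 `^ (- r)) ^+ i.1 j :> R.
    by apply: prodr_ge0 => j _; rewrite exprn_ge0// powR_ge0.
  case: ifP => [/andP[/eqP ni _]|_]; last by rewrite normr0 mulr_ge0// ltW.
  by rewrite ger0_norm// prodrXr ni.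
have negF x : tensor_sum (fun i => - co i) (@waves R d n L) x = - F x.
  by rewrite /F /tensor_sum -sumrN; apply: eq_bigr => i _; rewrite mulNr.
have F0 p : F (tnth xi p) = 0 by exact: fooling_eq0.
have XF : ((X * (2 * pi) ^+ d)%:E <= \int[lebesgueRn R d]_(x in torus R d) (F x)%:E)%E.
  have := @integral_fooling_ge R d n (Num.truncn r) m xi a hd m0 a0.
  apply: le_trans.
  by rewrite lee_fin.
have mF : measurable_fun (torus R d) (F : d.-tuple (measurableTypeR R) -> R).
  exact: measurable_fooling.
have Fge x : 0 <= F x by exact: fooling_ge0.
have [XL|XL] := L1norm_two_signs mF Fge (LM [tuple real_complex R 0 | _ < m]) XF.
  apply: le_trans XL _; apply: ereal_sup_ubound.
  exists (tensor_sumC co (@waves R d n L)); first exact: coH.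
  congr L1norm; apply/funext => x; congr (_ - M _ _).
  by apply: eq_from_tnth => p; rewrite !tnth_mktuple /tensor_sumC -/(F _) F0.
apply: le_trans XL _; apply: ereal_sup_ubound.
exists (tensor_sumC (fun i => - co i) (@waves R d n L)).
  by apply: coH => i; rewrite normrN.
congr L1norm; apply/funext => x; rewrite /tensor_sumC negF; congr (_ - M _ _).
by apply: eq_from_tnth => p; rewrite !tnth_mktuple negF F0 oppr0.
Qed.
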